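(* Let $e,r\geq1$ be integers, let $T$ be the Greenberg-Hastings cellular automaton with $e$ excited and $r$ refractory states, and let $Z$ be its pulse collision subsystem. The system $(Z,T|_Z)$ is chaotic in the sense of Devaney: (i) periodic orbits are dense in $Z$, (ii) it is topologically transitive, and (iii) it is sensitive with respect to initial conditions. In particular, $Z$ is contained in the non-wandering set of $T$, $Z\subset\Omega$.
   Context: Cellular automaton: $\mathcal A=\{0,1,\dots,e+r\}$, $E=\{1,\dots,e\}$. $X=\mathcal A^{\mathbb Z}$ carries the product topology, induced by the metric $d(x,y)=2^{-k}$ for $x\neq y$, where $k$ is maximal with $x_{[-k,k]}=y_{[-k,k]}$ ($k=-1$ if $x_0\ne y_0$), and $d(x,x)=0$. For $x\in X$, $(Tx)_k=x_k+1$ if $1\le x_k\le e+r-1$; $(Tx)_k=0$ if $x_k=e+r$; if $x_k=0$, then $(Tx)_k=1$ when $x_{k-1}\in E$ or $x_{k+1}\in E$, and $(Tx)_k=0$ otherwise. Write $x_{[i,j]}$ for the restriction of $x$ to coordinates $i,\dots,j$ (with $i=-\infty$ or $j=\infty$ allowed). Non-wandering set: $\Omega=\{x\in X:$ for every neighbourhood $U$ of $x$ there is $N\ge1$ with $T^N U\cap U\ne\emptyset\}$. Pulse collision subsystem $Z$ (a closed $T$-invariant subset of $X$): for $i,j\in\mathcal A$ put $a_{i,j}=1$ if $(i,j)=(0,0)$, or $j=i+1$ with $0\le i\le e+r-1$, or $(i,j)=(e+r,0)$; otherwise $a_{i,j}=0$. Let $S_R=\{x\in X: a_{x_i,x_{i-1}}=1\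 \forall i\in\mathbb Z\}$, $S_L=\{x\in X: a_{x_i,x_{i+1}}=1\ \forall i\in\mathbb Z\}$. For $p\in\mathbb Z$ let $S_{R,p}^-$ be the set of $x\in\mathcal A^{\mathbb Z_{\le p}}$ with $a_{x_i,x_{i-1}}=1$ for all $i\le p$, and $S_{L,p}^+$ the set of $x\in\mathcal A^{\mathbb Z_{\ge p}}$ with $a_{x_i,x_{i+1}}=1$ for all $i\ge p$. Let $S_L^R$ be the set of $x\in X\setminus(S_R\cup S_L)$ for which there is $p\in\mathbb Z$ with $x_{[-\infty,p]}\in S_{R,p}^-$ and $x_{[p+1,\infty]}\in S_{L,p+1}^+$; every such $p$ is called a separating position of $x$, and the set $I_{\mathrm{sp}}(x)$ of them is finite for $x\in S_L^R$. Then $Z$ is the set of $x\in X$ such that either $x\in S_R\cup S_L$, or $x\in S_L^R$ and, with $p=\max I_{\mathrm{sp}}(x)$, we have $x_{p+1}=x_p$ or ($x_{[-\infty,p]}\in S_{R,p}^-$ and $x_{[p,\infty]}\in S_{L,p}^+$). *)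

(* Defs.v *)
From HB Require Import structures.
From mathcomp Require Import all_boot all_order all_algebra.
From mathcomp Require Import all_classical all_reals topology.

Set Implicit Arguments.
Unset Strict Implicit.
Unset Printing Implicit Defensive.

Import Order.TTheory GRing.Theory Num.Theory.
Local Open Scope classical_set_scope.
Local Open Scope ring_scope.

(* Dynamics of f on an invariant subset A of M.  Open sets and neighbourhoods  *)
(* of the subspace A are traces on A of those of M.                            *)
Section Dynamics.
Context {M : topologicalType}.
Implicit Types (f : M -> M) (A : set M).

Definition periodic_point f : set M :=
  [set x | exists2 n : nat, (0 < n)%N & iter n f x = x].

Definition periodic_dense_on f A : Prop :=
  A `<=` closure (A `&` periodic_point f).

Definition transitive_on f A : Prop :=
  forall U V : set M, open U -> open V -> A `&` U !=set0 -> A `&` V !=set0 ->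
  exists2 n : nat, (0 < n)%N & (iter n f @` (A `&` U)) `&` (A `&` V) !=set0.

Definition sensitive_on {R : numDomainType} (d : M -> M -> R) f A : Prop :=
  exists2 delta : R, 0 < delta &
    forall x, A x -> forall U : set M, nbhs x U ->
    exists y, [/\ A y, U y & exists n : nat, delta < d (iter n f x) (iter n f y)].

Definition devaney_chaotic_on {R : numDomainType} (d : M -> M -> R) f A : Prop :=
  [/\ periodic_dense_on f A, transitive_on f A & sensitive_on d f A].

Definition non_wandering f : set M :=
  [set x | forall U : set M, nbhs x U ->
     exists2 N : nat, (0 < N)%N & (iter N f @` U) `&` U !=set0].

End Dynamics.

Section GreenbergHastings.
Context (e r : nat).

Definition state := 'I_(e + r).+1.

Definition config := prod_topology (fun _ : int => discrete_topology state).

Definition excited (a : state) : bool := (1 <= a <= e)%N.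

Definition T (x : config) : config := fun k =>
  let v : state := x k in
  if (1 <= v <= e + r - 1)%N then inord v.+1
  else if v == (e + r)%N :> nat then ord0
  else if excited (x (k - 1)) || excited (x (k + 1)) then inord 1
  else ord0.

(* x and y coincide on [-k, k]; this is vacuous for k = -1 *)
Definition agree (x y : config) (k : int) : Prop :=
  forall i : int, - k <= i <= k -> x i = y i.

(* the largest k such that x and y coincide on [-k, k]; it exists, and is at   *)
(* least -1, as soon as x <> y                                                 *)
Definition agreement (x y : config) : int :=
  xget (-1) [set k | agree x y k /\ ubound (agree x y) k].

Definition dist (R : realType) (x y : config) : R :=
  if `[< x = y >] then 0 else 2 ^ (- agreement x y).

(* adj i j is a_{i,j} = 1 *)
Definition adj (i j : state) : bool :=
  [|| (i == 0%N :> nat) && (j == 0%N :> nat),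
      (i <= e + r - 1)%N && (j == i.+1 :> nat)
    | (i == (e + r)%N :> nat) && (j == 0%N :> nat)].

Definition SR : set config := [set x | forall i : int, adj (x i) (x (i - 1))].

Definition SL : set config := [set x | forall i : int, adj (x i) (x (i + 1))].

(* SRminus p x: the restriction of x to ]-oo, p] lies in S_{R,p}^-.            *)
(* SLplus p x:  the restriction of x to [p, +oo[ lies in S_{L,p}^+.            *)
Definition SRminus (p : int) (x : config) : Prop :=
  forall i : int, i <= p -> adj (x i) (x (i - 1)).

Definition SLplus (p : int) (x : config) : Prop :=
  forall i : int, p <= i -> adj (x i) (x (i + 1)).

Definition Isp (x : config) : set int :=
  [set p | SRminus p x /\ SLplus (p + 1) x].

Definition SLR : set config :=
  [set x | ~ (SR `|` SL) x /\ Isp x !=set0].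

Definition Z : set config :=
  [set x | (SR `|` SL) x \/
    (SLR x /\ exists p : int,
       [/\ Isp x p, ubound (Isp x) p &
           x (p + 1) = x p \/ (SRminus p x /\ SLplus p x)])].

End GreenbergHastings.

(* Main.v *)
Require Import Defs.
From mathcomp Require Import all_boot all_order all_algebra.
From mathcomp Require Import all_classical all_reals topology.
From mathcomp Require Import zify.

(* A right-moving pulse train lifts to an integer height that never decreases to
   the left, with steps 0 (only at multiples of e + r + 1) or 1, and a left-moving
   one to a height of the same kind towards the right.  The points of Z are, on
   every finite window, the reductions modulo e + r + 1 of the maximum of two such
   heights, and conversely every such maximum lies in Z: an annihilating collision
   is exactly the place where the maximum changes sides.  In these coordinates T
   just translates the two heights towards each other, independently.
   Heights can be glued freely after adding a large multiple of e + r + 1 and a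
   long enough shift, and closed up quasi-periodically; this gives mixing of Z
   (hence transitivity and sensitivity) and density of periodic points. *)

Set Implicit Arguments.
Unset Strict Implicit.
Unset Printing Implicit Defensive.

Import Order.TTheory GRing.Theory Num.Theory.
Local Open Scope classical_set_scope.
Local Open Scope ring_scope.

(** * Integer heights: lattice operations, gluing and quasi-periodic closure *)

Section Climbs.
Context (M : int).
Implicit Types f g : int -> int.

Definition climb g : Prop :=
  forall i : int, g (i + 1) = g i + 1 \/ (g (i + 1) = g i /\ (M %| g i)%Z).

Lemma climb_step g (i : int) : climb g -> g i <= g (i + 1) <= g i + 1.
Proof. by move=> gc; case: (gc i) => [|[]] ->; lia. Qed.

Lemma climb_bound g (i j : int) : climb g -> i <= j -> g i <= g j <= g i + (j - i).
Proof.
move=> gc ij; have -> : j = i + `|j - i|%N by lia.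
elim: `|j - i|%N => [|n IH]; first by rewrite addr0; lia.
have := climb_step (i + n) gc.
have -> : i + n + 1 = i + n.+1 by lia.
by lia.
Qed.

Lemma climb_const b : (M %| b)%Z -> climb (fun=> b).
Proof. by move=> Mb i; right. Qed.

Lemma climb_line c : climb (fun i => i + c).
Proof. by move=> i; left; lia. Qed.

Lemma climb_shift g n c : climb g -> (M %| c)%Z -> climb (fun i => g (i + n) + c).
Proof.
move=> gc Mc i /=; have -> : i + 1 + n = i + n + 1 by lia.
case: (gc (i + n)) => [->|[-> Mg]]; first by left; rewrite addrAC.
by right; split=> //; rewrite rpredD.
Qed.

(** Steps are 0 or 1, so a strict inequality cannot be reversed in one step and only ties matter;
    there the maximum rests only if both heights rest, hence at a multiple of [M]. *)
Lemma climb_max f g : climb f -> climb g -> climb (fun i => Num.max (f i) (g i)).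
Proof.
move=> fc gc i /=; have := climb_step i fc; have := climb_step i gc.
have [lt|lt|eq] := ltgtP (f i) (g i) => Hg Hf.
- by rewrite max_r; [exact: gc|lia].
- by rewrite max_l; [exact: fc|lia].
- case: (fc i) => [->|[-> Mf]]; first by left; lia.
  by case: (gc i) => [->|[-> _]]; [left; lia|right; split=> //; lia].
Qed.

Lemma climb_min f g : climb f -> climb g -> climb (fun i => Num.min (f i) (g i)).
Proof.
move=> fc gc i /=; have := climb_step i fc; have := climb_step i gc.
have [lt|lt|eq] := ltgtP (f i) (g i) => Hg Hf.
- by rewrite min_l; [exact: fc|lia].
- by rewrite min_r; [exact: gc|lia].
- case: (fc i) => [->|[-> Mf]]; last by right; split=> //; lia.
  by case: (gc i) => [->|[-> Mg]]; [left; lia|right; split; [lia|rewrite eq]].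
Qed.

(* Past [k], [g1] rises to the multiple [b] of [M] and rests there until it can
   rise to the translate of [g2]: both ramps are cut out by lattice operations
   with lines of slope 1. *)
Lemma climb_glue g1 g2 (k : nat) : 0 < M -> climb g1 -> climb g2 ->
  exists c0 : int, forall c : int, c0 <= c -> (M %| c)%Z ->
  exists n0 : nat, forall n : nat, (n0 <= n)%N ->
  exists g, [/\ climb g, forall i : int, i <= k%:Z -> g i = g1 i &
    forall i : int, - k%:Z <= i -> g (i + n%:Z) = g2 i + c].
Proof.
move=> M0 g1c g2c; pose b : int := M * `|g1 k|; exists (b - g2 (- k%:Z)) => c cge Mc.
(* Such a delay keeps the last ramp below [g1] up to [k]; the bound [c0] ensures that the translate
   of [g2] starts no lower than the plateau [b]. *)
exists (`|(g2 (- k%:Z) + c - g1 k)%R| + 2 * k)%N => n nge.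
pose g3 (i : int) : int := g2 (i - n%:Z) + c.
pose k' : int := n%:Z - k%:Z.
have g3c : climb g3 by exact: climb_shift.
pose g (i : int) : int := Num.max (Num.min (Num.max (g1 i) (i + (g1 k - k%:Z))) b)
                    (Num.min (g3 i) (i + (g3 k' - k'))).
have bge : g1 k <= b by rewrite /b; nia.
have g3k : g3 k' = g2 (- k%:Z) + c by rewrite /g3 /k'; congr (g2 _ + _); lia.
exists g; split.
- apply: climb_max; apply: climb_min => //; try exact: climb_line.
    by apply: climb_max => //; exact: climb_line.
  by apply: climb_const; rewrite /b dvdz_mulr.
- move=> i ik; have := climb_bound g1c ik; rewrite /g g3k /k'; lia.
- move=> i ik; have ki : k' <= i + n%:Z by rewrite /k'; lia.
  have -> : g2 i + c = g3 (i + n%:Z) by rewrite /g3; congr (g2 _ + _); lia.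
  have kk : k%:Z <= i + n%:Z by lia.
  have := climb_bound g3c ki; have := climb_bound g1c kk; rewrite /g g3k /k'; lia.
Qed.

(** Glue [g] to its own translate, keep the block of length [n] starting at 0, and repeat it with
    [c] added each time. The negative half of the window reappears at the end of a block. *)
Lemma climb_periodize g (k : nat) : 0 < M -> climb g ->
  exists c0 : int, forall c : int, c0 <= c -> (M %| c)%Z ->
  exists n0 : nat, forall n : nat, (n0 <= n)%N ->
  exists p, [/\ climb p, forall i : int, - k%:Z <= i <= k%:Z -> p i = g i &
    forall i : int, p (i + n%:Z) = p i + c].
Proof.
move=> M0 gc; have [c0 Hc0] := climb_glue k M0 gc gc.
exists c0 => c cge Mc; have [n0 Hn0] := Hc0 c cge Mc.
(* The extra [k.+1] makes each half of the window fit in one block. *)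
exists (n0 + k.+1)%N => n nge.
have [|h [hc hl hr]] := Hn0 n; first by lia.
pose p i := h (i %% n%:Z)%Z + c * (i %/ n)%Z.
have n0' : n%:Z != 0 by lia.
have pE (q s : int) : 0 <= s < n -> p (q * n + s) = h s + c * q.
  by move=> sn; rewrite /p modzMDl modz_small ?divzMDl // divz_small ?addr0 //; lia.
have hn : h n = h 0 + c.
  by have := hr 0; rewrite add0r => ->; [rewrite hl|]; lia.
exists p; split.
- move=> i; have iE := divz_eq i n; move: (i %/ n)%Z iE => q iE.
  have := ltz_pmod i (_ : 0 < n%:Z); have := modz_ge0 i n0'.
  move: (i %% n)%Z iE => s -> s0 /(_ _) sn; have {}sn : s < n by apply: sn; lia.
  rewrite pE; last by lia.
  have -> : p (q * n + s + 1) = h (s + 1) + c * q.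
    have [s1n|] := ltrP (s + 1) n; first by rewrite -addrA pE //; lia.
    move=> ns; have sE : s + 1 = n by lia.
    have -> : q * n + s + 1 = (q + 1) * n + 0 by lia.
    by rewrite pE; [rewrite sE hn mulrDr mulr1 addrA addrAC|lia].
  case: (hc s) => [->|[-> Mh]]; [left; lia|right; split=> //].
  by rewrite rpredD // dvdz_mulr.
- move=> i ik; have [i0|i0] := leP 0 i.
    by have := pE 0 i; rewrite mul0r add0r mulr0 addr0 => ->; [rewrite hl|]; lia.
  have := pE (-1) (i + n%:Z).
  rewrite mulN1r [X in p X]addrC addrK mulrN1 => ->; last by lia.
  by rewrite hr ?addrK; lia.
- move=> i; rewrite /p modzDr divzDr ?dvdzz // divzz n0'; lia.
Qed.

End Climbs.

(** * Reduction of heights to states, and lifting back *)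

Section Heights.
Context (e r : nat).
Implicit Types (f g : int -> int) (x y : config e r).

Local Notation M := (Posz (e + r).+1).

Definition cell (a : int) : state e r := inord `|(a %% M)%Z|%N.

Lemma cellE a : (cell a : nat)%:Z = (a %% M)%Z.
Proof.
have := ltz_pmod a (_ : 0 < M); have := modz_ge0 a (_ : M != 0).
move=> /(_ _)/wrap[]// a0 /(_ _)/wrap[]// aM.
by rewrite /cell inordK; lia.
Qed.

Lemma cell0 a : (M %| a)%Z = (cell a == 0%N :> nat).
Proof.
apply/dvdz_mod0P/eqP => [a0|a0]; last by rewrite -cellE a0.
by have := cellE a; rewrite a0; lia.
Qed.

Lemma cellD a c : (M %| c)%Z -> cell (a + c) = cell a.
Proof.
by move=> /dvdzP[q ->]; rewrite /cell addrC modzMDl.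
Qed.

Lemma cell_small (n : nat) : (n <= e + r)%N -> (cell n : nat) = n.
Proof. by move=> ?; have := cellE n; rewrite modz_small; lia. Qed.

Lemma cellS a :
  (cell (a + 1) : nat) = if cell a == (e + r)%N :> nat then 0%N else (cell a).+1.
Proof.
have aE := divz_eq a M; rewrite -cellE in aE.
rewrite {1}aE -addrA addrC cellD ?dvdz_mull //.
have := ltn_ord (cell a); case: eqP => [-> _|ne lt].
  have -> : (e + r)%N%:Z + 1 = M by lia.
  by apply/eqP; rewrite -cell0 dvdzz.
have -> : (cell a : nat)%:Z + 1 = (cell a).+1 by lia.
by rewrite cell_small //; lia.
Qed.

Lemma adj_climb g i : climb M g -> adj (cell (g i)) (cell (g (i + 1))).
Proof.
move=> gc; rewrite /adj; case: (gc i) => [->|[-> ]].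
  by rewrite cellS; case: ifP; have := ltn_ord (cell (g i)); lia.
by rewrite cell0 => ->.
Qed.

(* [f] lifts the right-moving part and is read along decreasing coordinates. *)
Definition conf f g : config e r := fun i => cell (Num.max (f (- i)) (g i)).

(** The height gains 1 at each step except between two zeros. Fixing its value at [a] to be the
    state itself later lets the two lifts meet at a collision. *)
Lemma climb_lift (y : config e r) a : SLplus a y ->
  exists g, [/\ climb M g, g a = (y a : nat)%:Z & forall i : int, a <= i -> cell (g i) = y i].
Proof.
move=> ya; pose L := fix L (n : nat) : int := if n is n'.+1 then
  L n' + (if (y (a + n'%:Z) == 0%N :> nat) && (y (a + n) == 0%N :> nat) then 0 else 1)
  else (y a : nat)%:Z.
have LE n : cell (L n) = y (a + n%:Z).
  elim: n => [|n IH] /=.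
    by rewrite addr0; apply: ord_inj; rewrite cell_small // -ltnS ltn_ord.
  have := ya (a + n%:Z); have -> : a + n + 1 = a + n.+1 by lia.
  move=> /(_ _)/wrap[]; first by lia.
  move=> yn; apply: ord_inj; case: ifP => [|h].
    by rewrite addr0 IH => /andP[/eqP-> /eqP->].
  rewrite cellS IH; move: h yn (ltn_ord (y (a + n%:Z))) (ltn_ord (y (a + n.+1%:Z))).
  rewrite /adj.
  by case: ifP => ? ? ? ? ?; lia.
(* Left of [a] the lift has slope 1, which is allowed whatever the state at [a]. *)
pose g (i : int) : int := if a <= i then L `|(i - a)%R|%N else (y a : nat)%:Z - (a - i).
exists g; split.
- move=> i; rewrite /g; case: (leP a i) => ai; last first.
    left; case: (leP a (i + 1)) => ai'; last by lia.
    have -> : `|(i + 1 - a)%R|%N = 0%N by lia.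
    by rewrite /=; lia.
  have -> : a <= i + 1 by lia.
  have -> : `|(i + 1 - a)%R|%N = `|(i - a)%R|%N.+1 by lia.
  rewrite /=; have -> : a + `|(i - a)%R|%N%:Z = i by lia.
  case: ifP => [/andP[/eqP yi _]|_]; [right|by left].
  rewrite addr0 cell0 LE; split=> //.
  have -> : a + `|(i - a)%R|%N%:Z = i by lia.
  by rewrite yi.
- by rewrite /g lexx subrr.
- by move=> i ai; rewrite /g ai LE; congr y; lia.
Qed.

(** * Points of [Z] as maxima of two heights *)

(** As [i] decreases, [f (- i)] does not decrease and [g i] does not increase, so the comparison at
    [p] persists to its left and the maximum is read from [f]. *)
Lemma conf_SRminus f g p : climb M f -> climb M g -> g p <= f (- p) ->
  SRminus p (conf f g).
Proof.
move=> fc gc gf i ip; rewrite /conf.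
have fi : g i <= f (- i).
  have := climb_bound gc ip; have := @climb_bound M f (- p) (- i) fc; lia.
have iE : - (i - 1) = - i + 1 :> int by lia.
have gi : g (i - 1) <= g i by have := @climb_bound M g (i - 1) i gc; lia.
have fi1 := climb_step (- i) fc; rewrite -iE in fi1.
rewrite (max_l fi) max_l; last by lia.
rewrite iE; exact: adj_climb.
Qed.

Lemma conf_SLplus f g p : climb M f -> climb M g -> f (- p) <= g p ->
  SLplus p (conf f g).
Proof.
move=> fc gc fg i ip; rewrite /conf.
have gi : f (- i) <= g i.
  have := climb_bound gc ip; have := @climb_bound M f (- i) (- p) fc; lia.
have fi : f (- (i + 1)) <= f (- i).
  by have := @climb_bound M f (- (i + 1)) (- i) fc; lia.
have gi1 := climb_step i gc.
rewrite (max_r gi) max_r; last by lia.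
exact: adj_climb.
Qed.

Lemma SRminusW x (p q : int) : p <= q -> SRminus q x -> SRminus p x.
Proof. by move=> pq xq i ip; apply: xq; lia. Qed.

Lemma SLplusW x (p q : int) : p <= q -> SLplus p x -> SLplus q x.
Proof. by move=> pq xp i qi; apply: xp; lia. Qed.

Lemma conf_in_Z f g : climb M f -> climb M g -> Z (conf f g).
Proof.
move=> fc gc; set x := conf f g.
have [xS|xS] := pselect ((@SR e r `|` @SL e r) x); first by left.
have [l gl] : exists l : int, g l < f (- l).
  apply: contrapT => h; apply: xS; right => i.
  apply: (@conf_SLplus f g i) => //; rewrite leNgt; apply/negP => gi.
  by apply: h; exists i.
have [j fj] : exists j : int, f (- j) < g j.
  apply: contrapT => h; apply: xS; left => i.
  apply: (@conf_SRminus f g i) => //; rewrite leNgt; apply/negP => gi.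
  by apply: h; exists i.
(* Neither height dominates everywhere, so by monotonicity they cross; [q] is the last site before
   [g] takes over. *)
have [q gq fq] : exists2 q : int, g q <= f (- q) & f (- (q + 1)) < g (q + 1).
  have lj : l <= j.
    rewrite leNgt; apply/negP => jl.
    have := @climb_bound M g j l gc; have := @climb_bound M f (- l) (- j) fc; lia.
  have ex : exists n : nat, f (- (l + n%:Z)) < g (l + n%:Z).
    by exists `|(j - l)%R|%N; have -> : l + `|(j - l)%R|%N = j by lia.
  case: (ex_minnP ex) => -[|n] fn nmin.
    by move: fn; rewrite addr0; lia.
  exists (l + n%:Z).
    by rewrite leNgt; apply/negP => /nmin; rewrite ltnn.
  by have -> : l + n%:Z + 1 = l + n.+1%:Z by lia.
have xq : SRminus q x by exact: conf_SRminus.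
have xq1 : SLplus (q + 1) x by apply: conf_SLplus => //; exact: ltW.
(* The crossing need not be the largest separating position: that is [q + n], for the least [n] such
   that the right-moving rule fails at [q + n + 1]. *)
have ex : exists n : nat, `[< ~ SRminus (q + n.+1%:Z) x >].
  apply: contrapT => h; apply: xS; left => i.
  have [iq|qi] := leP i q; first exact: xq.
  apply: (_ : SRminus i x) => //; apply: contrapT => xi.
  apply: h; exists `|(i - q - 1)%R|%N; apply/asboolP.
  by have -> : q + `|(i - q - 1)%R|%N.+1%:Z = i by lia.
right; case: (ex_minnP ex) => n /asboolP xn nmin.
have xp : SRminus (q + n%:Z) x.
  case: n {xn} nmin => [|n] nmin; first by rewrite addr0.
  by apply: contrapT => /asboolP/nmin; rewrite ltnn.
have xIsp : Isp x (q + n%:Z) by split=> //; apply: SLplusW xq1; lia.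
split; first by split=> //; exists (q + n%:Z).
exists (q + n%:Z); split=> //.
  move=> p' [xp' _]; rewrite leNgt; apply/negP => pp'.
  by apply: xn; apply: SRminusW xp'; lia.
(* For positive [n] the position is past [q], where the left-moving rule already holds. *)
case: n {xn nmin} xp xIsp => [|n] xp _; last first.
  by right; split=> //; apply: SLplusW xq1; lia.
rewrite addr0.
have qE : - q = - (q + 1) + 1 :> int by lia.
have := climb_step q gc; have := climb_step (- (q + 1)) fc; rewrite -qE => fs gs.
(* Unit steps leave only [f (- q)] and [f (- q) + 1] as values of [g (q + 1)]; the second forces
   [g q = f (- q)]. *)
have [E|N] := eqVneq (g (q + 1)) (f (- q)).
  by left; rewrite /x /conf (max_l gq) (max_r (ltW fq)) E.
by right; split=> //; apply: conf_SLplus => //; lia.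
Qed.

(** A finite window is used because the lift of a pure train may be unbounded below; on the window
    the constant height 0 stays under it. In a collision both lifts start from the same value, so
    each dominates on its own side. *)
Lemma Z_conf x (k : nat) : Z x -> exists f g,
  [/\ climb M f, climb M g & forall i : int, - k%:Z <= i <= k%:Z -> conf f g i = x i].
Proof.
(* Reflection turns the right-moving part into a left-moving one, so [climb_lift] serves both. *)
pose y : config e r := fun i => x (- i).
have yx p : SRminus p x -> SLplus (- p) y.
  move=> xp i pi; rewrite /y; have -> : - (i + 1) = - i - 1 by lia.
  by apply: xp; lia.
have c0 : climb M (fun=> 0) by exact: climb_const.
case=> [[xR|xL]|[_ [p [[xp xp1] _ [xE|[_ xp']]]]]].
- have [f [fc fk fy]] := climb_lift (yx k (fun i _ => xR i)).
  exists f, (fun=> 0); split=> // i ik; rewrite /conf.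
  have := @climb_bound M f (- k%:Z) (- i) fc => fb.
  by rewrite max_l ?fy /y ?opprK //; lia.
- have [g [gc gk gx]] := @climb_lift x (- k%:Z) (fun i _ => xL i).
  exists (fun=> 0), g; split=> // i ik; rewrite /conf.
  have := @climb_bound M g (- k%:Z) i gc => gb.
  by rewrite max_r ?gx //; lia.
- have [f [fc fp fy]] := climb_lift (yx p xp).
  have [g [gc gp gx]] := climb_lift xp1.
  have {}fp : f (- p) = g (p + 1) by rewrite fp gp xE /y opprK.
  exists f, g; split=> // i _; rewrite /conf; case: (leP i p) => ip.
    have := @climb_bound M f (- p) (- i) fc => fb.
    have := @climb_bound M g i (p + 1) gc => gb.
    by rewrite max_l ?fy /y ?opprK //; lia.
  have := @climb_bound M f (- i) (- p) fc => fb.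
  have := @climb_bound M g (p + 1) i gc => gb.
  by rewrite max_r ?gx //; lia.
- have [f [fc fp fy]] := climb_lift (yx p xp).
  have [g [gc gp gx]] := climb_lift xp'.
  have {}fp : f (- p) = g p by rewrite fp gp /y opprK.
  exists f, g; split=> // i _; rewrite /conf; case: (leP i p) => ip.
    have := @climb_bound M f (- p) (- i) fc => fb.
    have := @climb_bound M g i p gc => gb.
    by rewrite max_l ?fy /y ?opprK //; lia.
  have := @climb_bound M f (- i) (- p) fc => fb.
  have := @climb_bound M g p i gc => gb.
  by rewrite max_r ?gx //; lia.
Qed.

(** * The automaton as a translation of heights *)

(** Off the multiples of [M] the dominating height must rise, matching the forced increment of [T].
    At a multiple, the maximum rises exactly when a neighbour is one higher, that is in state 1. *)
Lemma T_conf f g : (1 <= e)%N -> (1 <= r)%N -> climb M f -> climb M g ->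
  T (conf f g) = conf (fun i => f (i + 1)) (fun i => g (i + 1)).
Proof.
move=> e1 r1 fc gc; apply/funext => k.
have kE : - (k - 1) = - k + 1 :> int by lia.
have kE' : - k = - (k + 1) + 1 :> int by lia.
have gE : k = k - 1 + 1 :> int by lia.
rewrite /T /conf.
have [fs gs] := (climb_step (- k) fc, climb_step k gc).
have fck := fc (- k); rewrite -kE in fs fck.
have fs' := climb_step (- (k + 1)) fc; rewrite -kE' in fs'.
have gs' := climb_step (k - 1) gc; rewrite -gE in gs'.
set h := Num.max (f (- k)) (g k).
rewrite -kE; set h' := Num.max (f (- (k - 1))) (g (k + 1)).
set h1 := Num.max (f (- (k - 1))) (g (k - 1)).
set h2 := Num.max (f (- (k + 1))) (g (k + 1)).
have [/eqP h0|hn0] := boolP (cell h == 0%N :> nat); last first.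
  have h'E : h' = h + 1.
    have Mh : ~ (M %| h)%Z by rewrite cell0; exact/negP.
    move: Mh; rewrite /h' /h; have [fg|gf] := leP (f (- k)) (g k) => Mh.
      by case: (gc k) => [->|[_ /Mh//]]; clear -fg fs; lia.
    by case: fck => [->|[_ /Mh//]]; clear -gf gs; lia.
  rewrite h'E; apply: ord_inj; rewrite cellS; have := ltn_ord (cell h).
  case: ifP => [v1 v2|v1 v2]; first by rewrite inordK; [case: eqP|]; lia.
  by have -> : (cell h == (e + r)%N :> nat) by lia.
have Mh : (M %| h)%Z by rewrite cell0 h0.
rewrite h0 /=.
have -> : (0%N == (e + r)%N) = false by lia.
have [h'E|h'E] : h' = h \/ h' = h + 1 by rewrite /h' /h; clear -fs gs; lia.
(* A neighbour at [h - 1] is in state [e + r], which is not excited because [r] is positive. *)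
- have nexc j : j = h \/ j = h - 1 -> excited (cell j) = false.
    rewrite /excited; case=> ->; first by rewrite h0.
    by have := cellS (h - 1); rewrite subrK h0; case: ifP => // /eqP ->; lia.
  have h1E : h1 = h \/ h1 = h - 1.
    by move: h'E; rewrite /h1 /h' /h; clear -fs gs gs'; lia.
  have h2E : h2 = h \/ h2 = h - 1.
    by move: h'E; rewrite /h2 /h' /h; clear -fs gs fs'; lia.
  rewrite !nexc //=.
  by apply: ord_inj; rewrite h'E h0.
- have hS : (cell (h + 1) : nat) = 1%N.
    by rewrite cellS h0; case: ifP => // /eqP; lia.
  have exc : excited (cell (h + 1)) by rewrite /excited hS.
  have [->|->] : h1 = h + 1 \/ h2 = h + 1.
    by move: h'E; rewrite /h1 /h2 /h' /h; clear -fs gs fs' gs'; lia.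
  + by rewrite exc; apply: ord_inj; rewrite h'E hS inordK //; clear -e1; lia.
  + by rewrite exc orbT; apply: ord_inj; rewrite h'E hS inordK //; clear -e1; lia.
Qed.

Lemma climb_iter_shift g n : climb M g -> climb M (fun i => g (i + n)).
Proof. by move=> gc i; rewrite addrAC; exact: gc. Qed.

Lemma iter_T_conf f g n : (1 <= e)%N -> (1 <= r)%N -> climb M f -> climb M g ->
  iter n (@T e r) (conf f g) = conf (fun i => f (i + n%:Z)) (fun i => g (i + n%:Z)).
Proof.
move=> e1 r1 fc gc; elim: n => [|n IH] /=.
  by congr conf; apply/funext => i; rewrite addr0.
rewrite IH T_conf //; try exact: climb_iter_shift.
by congr conf; apply/funext => i; congr (_ _); lia.
Qed.

(** * Mixing and periodic points *)

Lemma Z_mixing x y (k : nat) : (1 <= e)%N -> (1 <= r)%N -> Z x -> Z y ->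
  exists n0 : nat, forall n : nat, (n0 <= n)%N ->
  exists z, [/\ Z z, Z (iter n (@T e r) z),
    agree z x k%:Z & agree (iter n (@T e r) z) y k%:Z].
Proof.
move=> e1 r1 /(@Z_conf _ k)[f1 [g1 [f1c g1c xE]]].
move=> /(@Z_conf _ k)[f2 [g2 [f2c g2c yE]]].
have M0 : 0 < M by [].
have [cf Hf] := climb_glue k M0 f1c f2c.
have [cg Hg] := climb_glue k M0 g1c g2c.
(* Both heights must be raised by the same multiple of [M], so that the maximum is raised by it too
   and its reduction is unchanged. *)
pose c : int := M * (`|cf| + `|cg|).
have Mc : (M %| c)%Z by rewrite dvdz_mulr.
have [|nf {}Hf] := Hf c _ Mc; first by rewrite /c; nia.
have [|ng {}Hg] := Hg c _ Mc; first by rewrite /c; nia.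
exists (nf + ng)%N => n nn.
have [|f [fc fl fr]] := Hf n; first by lia.
have [|g [gc gl gr]] := Hg n; first by lia.
exists (conf f g); split; first exact: conf_in_Z.
- by rewrite iter_T_conf //; apply: conf_in_Z; apply: climb_iter_shift.
- by move=> i ik; rewrite -xE // /conf fl ?gl //; lia.
- move=> i ik; rewrite -yE // iter_T_conf // /conf fr ?gr; try lia.
  by rewrite -addr_maxl cellD.
Qed.

(** With a common period and a common increment for both heights, iterating over one period adds a
    multiple of [M] to the maximum. *)
Lemma Z_periodic_approx x (k : nat) : (1 <= e)%N -> (1 <= r)%N -> Z x ->
  exists z, [/\ Z z, periodic_point (@T e r) z & agree z x k%:Z].
Proof.
move=> e1 r1 /(@Z_conf _ k)[f1 [g1 [f1c g1c xE]]].
have M0 : 0 < M by [].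
have [cf Hf] := climb_periodize k M0 f1c.
have [cg Hg] := climb_periodize k M0 g1c.
pose c : int := M * (`|cf| + `|cg|).
have Mc : (M %| c)%Z by rewrite dvdz_mulr.
have [|nf {}Hf] := Hf c _ Mc; first by rewrite /c; nia.
have [|ng {}Hg] := Hg c _ Mc; first by rewrite /c; nia.
have [|f [fc fk fn]] := Hf (nf + ng).+1; first by lia.
have [|g [gc gk gn]] := Hg (nf + ng).+1; first by lia.
exists (conf f g); split; first exact: conf_in_Z.
- exists (nf + ng).+1 => //; rewrite iter_T_conf //; apply/funext => i.
  by rewrite /conf fn gn -addr_maxl cellD.
- by move=> i ik; rewrite -xE // /conf fk ?gk //; lia.
Qed.

(** * Cylinders, neighbourhoods and the metric *)

Lemma nbhs_agree x (U : set (config e r)) : nbhs x U ->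
  exists k : nat, forall y, agree y x k%:Z -> U y.
Proof.
pose B (k : nat) := [set y : config e r | agree y x k%:Z].
pose F := filter_from setT B.
suff Fx : F --> x by move=> /Fx[k _ kU]; exists k.
have FF : Filter F.
  apply: filter_from_filter; first by exists 0%N.
  move=> i j _ _; exists (maxn i j) => // y yB.
  by split=> l ll; apply: yB; lia.
(* The product topology is the supremum of those induced by the coordinates, so convergence of the
   cylinder filter is checked one coordinate at a time. *)
apply/cvg_sup => i; apply/cvg_image.
  by apply/seteqP; split=> // a _; exists (fun=> a).
move=> V /nbhs_singleton Vx.
exists [set y | V (y i)].
  exists `|i|%N => // y yB /=; have -> : y i = x i by apply: yB; lia.
  exact: Vx.
apply/seteqP; split=> [a [y Vy <-]//|a Va].
by exists (fun=> a).
Qed.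

(** Disagreement at 0 means agreement index -1, hence distance 2. *)
Lemma dist_gt1 (R : realType) x y : x 0 <> y 0 -> 1 < dist R x y.
Proof.
move=> xy; rewrite /dist asboolF => [|E]; last by apply: xy; rewrite E.
have agreeN k : agree x y k -> k <= -1.
  by move=> a; rewrite leNgt; apply/negP => k1; apply: xy; apply: a; lia.
have agree1 : agree x y (-1) by move=> i; lia.
suff -> : agreement x y = -1 by rewrite opprK expr1z ltr1n.
by apply: xget_unique => // k [/agreeN k1 /(_ _ agree1) k2]; lia.
Qed.

End Heights.

Theorem proposition3p2 (R : realType) (e r : nat) (he : (1 <= e)%N) (hr : (1 <= r)%N) :
  devaney_chaotic_on (@dist e r R) (@T e r) (@Z e r) /\
  @Z e r `<=` non_wandering (@T e r).
Proof.
have per x U : Z x -> nbhs x U -> exists z, [/\ Z z, periodic_point (@T e r) z & U z].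
  move=> Zx /nbhs_agree[k kU]; have [z [Zz zp zx]] := Z_periodic_approx k he hr Zx.
  by exists z; split=> //; apply: kU.
split; [split|].
- move=> x Zx U xU; have [z [Zz zp Uz]] := per x U Zx xU.
  by exists z.
- move=> U V oU oV [x [Zx Ux]] [y [Zy Vy]].
  have [k kU] := nbhs_agree (open_nbhs_nbhs (conj oU Ux)).
  have [l lV] := nbhs_agree (open_nbhs_nbhs (conj oV Vy)).
  have [n0 /(_ n0.+1)[//|z [Zz Zn zx zy]]] := Z_mixing (k + l) he hr Zx Zy.
  exists n0.+1 => //; exists (iter n0.+1 (@T e r) z); split.
    by exists z => //; split=> //; apply: kU => i il; apply: zx; lia.
  by split=> //; apply: lV => i il; apply: zy; lia.
(* By mixing, two points near [x] show states 0 and 1 at the origin at a common time; the orbit of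
   [x] then differs there from at least one of them. *)
- exists 1 => // x Zx U /nbhs_agree[k kU].
  pose u : config e r := conf e r (fun=> 0) (fun=> 0).
  pose v : config e r := conf e r (fun i => i + 1) (fun i => i + 1).
  have Zu : Z u by apply: conf_in_Z; apply: climb_const.
  have Zv : Z v by apply: conf_in_Z; apply: climb_line.
  have uv : u 0 <> v 0.
    rewrite /u /v /conf => /(congr1 (fun a : state e r => a : nat)).
    rewrite oppr0 add0r !maxxx.
    by rewrite (@cell_small e r 0) // (@cell_small e r 1) //; lia.
  have [n1 Hu] := Z_mixing k he hr Zx Zu.
  have [n2 Hv] := Z_mixing k he hr Zx Zv.
  have [|y [Zy _ yx yu]] := Hu (n1 + n2)%N; first by lia.
  have [|z [Zz _ zx zv]] := Hv (n1 + n2)%N; first by lia.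
  have {}yu := yu 0 _; have {}zv := zv 0 _.
  have [E|N] := pselect (iter (n1 + n2) (@T e r) x 0 = u 0).
    exists z; split=> //; first exact: kU.
    by exists (n1 + n2)%N; apply: dist_gt1; rewrite E zv //; lia.
  exists y; split=> //; first exact: kU.
  by exists (n1 + n2)%N; apply: dist_gt1; rewrite yu //; lia.
- move=> x Zx U xU; have [z [_ [n n0 nz] Uz]] := per x U Zx xU.
  by exists n => //; exists z; split=> //; exists z.
Qed.
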